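(* Let $n, m \geq 1$ be integers, let $U \subseteq \mathbb{R}^n$ be open, and let $f: U \to \mathbb{R}$ be positive homogeneous of degree $m$ and have continuous partial derivatives of order $m$ in $U$ (i.e. $f$ is $m$-times continuously differentiable in $U$). Let $a, b \in U$ be such that the line segment connecting $a$ and $b$ lies in $U$. Then the Taylor polynomial for $f(b)$ of order $m$ at $a$ is given by $$T^{(m)} f(a; b-a) = \frac{1}{m!}\, d^m f(a; b).$$
   Context: Positive homogeneity: a function $f: U \to \mathbb{R}$ on an open set $U \subseteq \mathbb{R}^n$ is positive homogeneous of degree $m$ if $f(\lambda x) = \lambda^m f(x)$ for all $x \in U$ and all $\lambda > 0$ with $\lambda x \in U$. Higher derivatives: for an integer $j \geq 1$, $x \in U$ and $t = (t_1,\ldots,t_n) \in \mathbb{R}^n$, $$d^j f(x; t) = \sum_{k \in \{1,\ldots,n\}^j} D_k f(x)\, t_{k_1} \cdots t_{k_j},$$ where for $k = (k_1,\ldots,k_j)$, $D_k f = \frac{\partial^j f}{\partial x_{k_1} \cdots \partial x_{k_j}}$ is the iterated partial derivative. Taylor polynomial: for $f$ with continuous partial derivatives of order $m$ in $U$, and $a,b \in U$ with the segment from $a$ to $b$ contained in $U$, $$T^{(m)} f(a; b-a) = f(a) + \sum_{k=1}^m \frac{1}{k!}\, d^k f(a; b-a).$$ *)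

(* Defs.v *)
From HB Require Import structures.
From mathcomp Require Import all_boot all_order all_algebra.
From mathcomp Require Import all_classical all_reals all_analysis.

Set Implicit Arguments.
Unset Strict Implicit.
Unset Printing Implicit Defensive.

Import Order.TTheory GRing.Theory Num.Theory.
Import numFieldNormedType.Exports.

Local Open Scope classical_set_scope.
Local Open Scope ring_scope.

(* A function on an open set U is represented by a total function on 'rV[R]_n
   of which only the values on U are constrained; the iterated partial
   derivatives at a point of U depend on these values only. *)

Definition pos_homogeneous (R : realType) (n : nat)
    (U : set 'rV[R]_n) (m : nat) (f : 'rV[R]_n -> R) : Prop :=
  forall (x : 'rV[R]_n) (l : R),
    U x -> 0 < l -> U (l *: x) -> f (l *: x) = l ^+ m * f x.

Definition partial (R : realType) (n : nat) (i : 'I_n) (f : 'rV[R]_n -> R) :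
    'rV[R]_n -> R :=
  fun x => 'D_(delta_mx 0 i) f x.

(* partials [:: k_1; ...; k_j] f = D_{k_1} (D_{k_2} (... (D_{k_j} f))) *)
Definition partials (R : realType) (n : nat) (k : seq 'I_n)
    (f : 'rV[R]_n -> R) : 'rV[R]_n -> R :=
  foldr (@partial R n) f k.

(* The derivative 'D_v is total, so that the existence of the iterated partial
   derivatives up to order m has to be required separately. The continuity of
   f and of the partial derivatives of order < m on the open set U follows. *)
Definition continuous_partials (R : realType) (n : nat)
    (U : set 'rV[R]_n) (m : nat) (f : 'rV[R]_n -> R) : Prop :=
  (forall (k : seq 'I_n) (i : 'I_n) (x : 'rV[R]_n), (size k < m)%N -> U x ->
     derivable (partials k f) x (delta_mx 0 i)) /\
  (forall (k : m.-tuple 'I_n) (x : 'rV[R]_n), U x ->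
     {for x, continuous (partials k f)}).

Definition higher_diff (R : realType) (n : nat) (j : nat)
    (f : 'rV[R]_n -> R) (x t : 'rV[R]_n) : R :=
  \sum_(k : j.-tuple 'I_n) partials k f x * \prod_(l < j) t 0 (tnth k l).

Definition taylor_poly (R : realType) (n : nat) (m : nat)
    (f : 'rV[R]_n -> R) (a h : 'rV[R]_n) : R :=
  f a + \sum_(1 <= k < m.+1) (k`!%:R)^-1 * higher_diff k f a h.

(* Main.v *)
(* Put h = b - a and move along the line x = a + s b for s near 0, where x stays
   in U. There (1 + s) b = x + h, so a derivative along b is, up to the factor
   1 + s, the sum of a radial derivative and a derivative along h. The function
   v_i(s) = d^i f(x; h) is positive homogeneous of degree m - i in x, so Euler's
   identity gives (1 + s) v_i' = (m - i) v_i + v_(i+1). Since d^j f(x; b) is the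
   j-th derivative of v_0, induction on j yields
     (m - j)! (1 + s)^j d^j f(x; b) = sum_(i <= j) C(j, i) (m - i)! v_i(s),
   and j = m, s = 0 is the claim. Neither the symmetry of mixed partial
   derivatives nor the remainder in Taylor's formula is needed. *)
Require Import Defs.
From HB Require Import structures.
From mathcomp Require Import all_boot all_order all_algebra.
From mathcomp Require Import all_classical all_reals all_analysis.
From mathcomp Require Import ring.
Set Implicit Arguments.
Unset Strict Implicit.
Unset Printing Implicit Defensive.
Import Order.TTheory GRing.Theory Num.Theory.
Import numFieldNormedType.Exports.
Local Open Scope classical_set_scope.
Local Open Scope ring_scope.

(** * Restriction of a function to a line *)

Lemma is_derive_line (R : numFieldType) (V W : normedModType R) (g : V -> W)
    (v y : V) (t : R) (d : W) :
  is_derive (t *: v + y) v g d -> is_derive t 1 (fun s : R => g (s *: v + y)) d.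
Proof.
have E : (fun h : R => h^-1 *: ((g \o shift (t *: v + y)) (h *: v)
    - g (t *: v + y))) =
  (fun h : R => h^-1 *: (((fun s : R => g (s *: v + y)) \o shift t) (h *: 1)
    - g (t *: v + y))).
  by apply/funext => h /=; rewrite [_%:A]mulr1 scalerDl addrA.
move=> [dg <-]; split; first by move: dg; rewrite /derivable E.
by rewrite /derive E.
Qed.

(** The mean value theorem wants ordered endpoints, hence the split on the sign of [c]. The bound on
    [t] by absolute values covers both signs and suffices to stay in a ball. *)
Lemma MVT_line (R : realType) (V : normedModType R) (g : V -> R) (v y : V)
    (c : R) :
  (forall t : R, `|t| <= `|c| -> derivable g (t *: v + y) v) ->
  exists2 t, `|t| <= `|c| &
    g (c *: v + y) - g y = c * 'D_v g (t *: v + y).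
Proof.
move=> dg; pose phi (t : R) : R := g (t *: v + y).
have dphi (t : R) : `|t| <= `|c| -> is_derive t 1 phi ('D_v g (t *: v + y)).
  by move=> tc; apply: is_derive_line; apply/derivableP/dg.
have mvt a b : a <= b -> (forall t : R, t \in `[a, b] -> `|t| <= `|c|) ->
    exists2 t : R, `|t| <= `|c| & phi b - phi a = 'D_v g (t *: v + y) * (b - a).
  move=> ab abc.
  have dab t : t \in `]a, b[ -> is_derive t 1 phi ('D_v g (t *: v + y)).
    by move=> tab; apply/dphi/abc; exact: subset_itv_oo_cc tab.
  have cab : {within `[a, b], continuous phi}.
    apply: derivable_within_continuous => t tab.
    by have [] := dphi t (abc t tab).
  by have [t /abc tc ->] := MVT_segment ab dab cab; exists t.
case: (leP 0 c) => c0.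
  have [|t tc] := mvt 0 c c0.
    by move=> t; rewrite in_itv/= => /andP[t0 tc]; rewrite !ger0_norm.
  rewrite /phi scale0r add0r subr0 => ->.
  by exists t => //; rewrite mulrC.
have [|t tc] := mvt c 0 (ltW c0).
  move=> t; rewrite in_itv/= => /andP[ct t0].
  by rewrite !ler0_norm ?lerN2// ltW.
rewrite /phi scale0r add0r sub0r mulrN => e.
by exists t => //; rewrite mulrC -[RHS]opprK -e opprB.
Qed.

(** * Differentiability from continuous partial derivatives *)

Lemma coord_le_norm (R : realType) n (h : 'rV[R]_n) i : `|h 0 i| <= `|h|.
Proof.
rewrite [leRHS]/Num.norm /= mx_normrE.
exact: (le_bigmax _ (fun ij : 'I_1 * 'I_n => `|h ij.1 ij.2|) (0, i)).
Qed.

Lemma norm_le_coord (R : realType) n (h : 'rV[R]_n) (e : R) : 0 <= e ->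
  (forall i, `|h 0 i| <= e) -> `|h| <= e.
Proof.
move=> e0 he; rewrite [leLHS]/Num.norm /= mx_normrE.
by apply/bigmax_leP; split => // -[i j] _ /=; rewrite (ord1 i).
Qed.

(** When one coordinate changes at a time, each increment is that coordinate of [h] times a partial
    derivative at a point near [x], and continuity compares this derivative with its value at
    [x]. *)
Lemma littleo_gradient (R : realType) (n : nat) (g : 'rV[R]_n -> R)
    (x : 'rV[R]_n) :
  (\forall y \near x, forall i, derivable g y (delta_mx 0 i)) ->
  (forall i, {for x, continuous (partial i g)}) ->
  forall e : R, 0 < e -> \forall h \near (0 : 'rV[R]_n),
  `|g (h + x) - g x - \sum_i h 0 i * partial i g x| <= e * `|h|.
Proof.
(* Each of the [n] coordinates costs at most [e' * |h|]; dividing by [n.+1] keeps [e'] positive also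
   for [n = 0]. *)
move=> dg cg e e0; pose e' := e / n.+1%:R.
have e'0 : 0 < e' by rewrite divr_gt0.
have : \forall y \near x, forall i, derivable g y (delta_mx 0 i) /\
    `|partial i g x - partial i g y| < e'.
  apply: (@filter_forall _ _ (fun (i : 'I_n) y =>
    derivable g y (delta_mx 0 i) /\ `|partial i g x - partial i g y| < e')
    _ (nbhs_filter x)) => i.
  have /cvgrPdist_lt/(_ _ e'0) ci := cg i.
  by apply: filterS2 dg ci => y dy cy; split.
move=> /nbhs_ballP[d /= d0 xd]; apply/nbhs_ballP; exists d => //= h.
rewrite -ball_normE /= sub0r normrN => hd.
(* Coordinatewise path from [x] to [h + x]. *)
pose P k : 'rV[R]_n := (\row_i if (i < k)%N then h 0 i else 0) + x.
have -> : g (h + x) - g x = \sum_(i < n) (g (P i.+1) - g (P i)).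
  rewrite -(big_mkord xpredT (fun i => g (P i.+1) - g (P i))) telescope_sumr//.
  congr (g _ - g _).
    by congr (_ + _); apply/rowP => i; rewrite !mxE ltn_ord.
  by rewrite -[LHS]add0r; congr (_ + _); apply/rowP => i; rewrite !mxE.
rewrite -sumrB (le_trans (ler_norm_sum _ _ _))//.
apply: (@le_trans _ _ (\sum_(i < n) e' * `|h|)); last first.
  rewrite sumr_const card_ord -mulr_natl mulrA ler_wpM2r//.
  rewrite /e' mulrCA ler_piMr ?(ltW e0)// ler_pdivrMr// mul1r ler_nat//.
apply: ler_sum => i _.
(* The displacement from [x] has coordinates [h_j] before [i], [t] at [i] and 0 afterwards, so its
   sup norm is at most that of [h]. *)
have inball (t : R) : `|t| <= `|h 0 i| -> ball x d (t *: delta_mx 0 i + P i).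
  move=> th; rewrite -ball_normE /= /P addrA opprD addrCA subrr addr0 normrN.
  apply: le_lt_trans hd.
  apply: norm_le_coord => // j; rewrite !mxE eqxx /=.
  have [->|ji] := eqVneq j i.
    by rewrite ltnn mulr1 addr0 (le_trans th) ?coord_le_norm.
  rewrite mulr0 add0r; case: ifP; first by rewrite coord_le_norm.
  by rewrite normr0.
have -> : P i.+1 = h 0 i *: delta_mx 0 i + P i.
  rewrite /P addrA; congr (_ + _); apply/rowP => j; rewrite !mxE eqxx /=.
  rewrite ltnS leq_eqVlt; have [->|ji] := eqVneq j i.
    by rewrite eqxx /= ltnn mulr1 addr0.
  by rewrite (negbTE (_ : val j != val i)) //= mulr0 add0r.
have [t /inball /xd/(_ i)[_ ht] ->] : exists2 t : R, `|t| <= `|h 0 i| &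
    g (h 0 i *: delta_mx 0 i + P i) - g (P i) =
    h 0 i * 'D_(delta_mx 0 i) g (t *: delta_mx 0 i + P i).
  by apply: MVT_line => t /inball/xd/(_ i)[].
rewrite -mulrBr normrM mulrC ler_pM ?coord_le_norm// distrC.
exact: ltW ht.
Qed.

Lemma linear_approx_differentiable (R : numFieldType) (V W : normedModType R)
    (f : V -> W) (L : {linear V -> W}) (x : V) : continuous L ->
  (forall e : R, 0 < e ->
    \forall h \near (0 : V), `|f (h + x) - f x - L h| <= e * `|h|) ->
  differentiable f x.
Proof.
move=> Lc fL.
have E : f \o shift x = cst (f x) + L +o_ 0 id.
  apply/eqaddoP => e e0; apply: filterS (fL e e0) => h.
  by rewrite !fctE opprD addrA.
by apply/diff_locallyP; rewrite (diff_unique Lc E).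
Qed.

Lemma differentiable_partials (R : realType) (n : nat) (g : 'rV[R]_n -> R)
    (x : 'rV[R]_n) :
  (\forall y \near x, forall i, derivable g y (delta_mx 0 i)) ->
  (forall i, {for x, continuous (partial i g)}) ->
  differentiable g x.
Proof.
move=> dg cg.
pose L (h : 'rV[R]_n) : R := \sum_i h 0 i * partial i g x.
have L_lin : linear L.
  move=> c u v; rewrite /L scaler_sumr -big_split /=; apply: eq_bigr => i _.
  by rewrite !mxE mulrDl -mulrA.
have Lcont : continuous L.
  apply: continuous_big => [|i _ y]; first exact: add_continuous.
  by apply: cvgMr_tmp; [exact: nbhs_filter|exact: coord_continuous].
pose LM := GRing.isLinear.Build _ _ _ _ _ L_lin.
pose Llin : {linear _ -> _} := HB.pack L LM.
have gL := littleo_gradient dg cg.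
exact: (linear_approx_differentiable (L := Llin) Lcont gL).
Qed.

(** * Euler's identity and homogeneity of partial derivatives *)

(** Both sides are the derivative at [s = 0] of [g ((1 + s) x) = (1 + s)^p g x]. Homogeneity is
    local in [l] because only scalings that stay in an open set are available. *)
Lemma euler_identity (R : realType) (V : normedModType R) (g : V -> R) (p : nat)
    (x : V) : differentiable g x ->
  (\forall l \near (1 : R), g (l *: x) = l ^+ p * g x) ->
  'D_x g x = p%:R * g x.
Proof.
move=> dg hg.
have D1 : is_derive (0 : R) 1 (fun s : R => g (s *: x + x)) ('D_x g x).
  apply: is_derive_line; rewrite scale0r add0r.
  exact/derivableP/diff_derivable.
have D2 : is_derive (0 : R) 1 (fun s : R => (s + 1) ^+ p * g x) (p%:R * g x).
  rewrite (_ : (fun s => _) = (id + cst 1) ^+ p * cst (g x)); last first.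
    by apply/funext => s; rewrite !fctE.
  apply: is_derive_eq.
  rewrite !fctE scaler0 add0r add0r expr1n addr0.
  by rewrite /GRing.scale /= !mulr1 mulrC.
have N : \forall s \near (0 : R), (s + 1) ^+ p * g x = g (s *: x + x).
  have : (s + 1) @[s --> (0 : R)] --> (1 : R).
    rewrite -[X in _ --> X]add0r.
    by apply: cvgD; [exact: cvg_id|exact: cvg_cst].
  move=> /(_ _ hg); apply: (@filterS _ _ (nbhs_filter (0 : R))) => s /= <-.
  by rewrite scalerDl scale1r.
by have [_ <-] := D1; have [_ <-] := near_eq_is_derive N D2.
Qed.

(** Differentiating [g (l x) = l^(p+1) g x] in [x] produces a factor [l] on the left by the chain
    rule, which is then cancelled. *)
Lemma pos_homogeneous_partial (R : realType) (n : nat) (U : set 'rV[R]_n)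
    (g : 'rV[R]_n -> R) (p : nat) (i : 'I_n) :
  open U -> (forall x, U x -> differentiable g x) ->
  pos_homogeneous U p.+1 g -> pos_homogeneous U p (partial i g).
Proof.
move=> oU dg hg x l Ux l0 Ulx; rewrite /partial; set e := delta_mx 0 i.
have N : \forall y \near x, g (l *: y) = l ^+ p.+1 * g y.
  have sx : {for x, continuous ( *:%R l : 'rV[R]_n -> 'rV[R]_n)}.
    exact: differentiable_continuous.
  have /sx NU : nbhs (l *: x) U by apply: open_nbhs_nbhs.
  have NUx : nbhs x U by apply: open_nbhs_nbhs.
  by apply: filterS2 NUx NU => y Uy Uly; apply: hg.
have := near_eq_derive e N.
have -> : 'D_e (fun y => g (l *: y)) x = l * 'D_e g (l *: x).
  rewrite (deriveE _ (dg _ Ulx)) -[LHS]/('D_e (g \o ( *:%R l)) x).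
  have dl : differentiable ( *:%R l : 'rV[R]_n -> 'rV[R]_n) x by [].
  rewrite deriveE; last by apply: differentiable_comp => //; exact: dg.
  rewrite diff_comp//; last exact: dg.
  by rewrite /= [X in _ (X e)]diff_val linearZ.
rewrite (_ : (fun y => _) = l ^+ p.+1 *: g)// deriveZ; last first.
  exact/diff_derivable/dg.
by rewrite exprS -scalerA => /mulfI -> //; rewrite gt_eqF.
Qed.

(** * Calculus of the higher differentials *)

Lemma derive_row (R : realType) (n : nat) (g : 'rV[R]_n -> R)
    (x v : 'rV[R]_n) : differentiable g x ->
  'D_v g x = \sum_i v 0 i * partial i g x.
Proof.
move=> dg; rewrite deriveE// [in LHS](row_sum_delta v) linear_sum.
by apply: eq_bigr => i _; rewrite linearZ /partial deriveE.
Qed.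

Lemma sum_tuple_cons (M : nmodType) (T : finType) (j : nat)
    (F : j.+1.-tuple T -> M) :
  \sum_k F k = \sum_(i : T) \sum_(k : j.-tuple T) F [tuple of i :: k].
Proof.
rewrite pair_bigA /=.
apply: (reindex (fun p : T * j.-tuple T => [tuple of p.1 :: p.2])).
exists (fun k => (thead k, [tuple of behead k])) => [[i k] _|k _] /=.
  by congr pair; apply: val_inj.
by rewrite -tuple_eta.
Qed.

Lemma higher_diff0 (R : realType) (n : nat) (f : 'rV[R]_n -> R)
    (x t : 'rV[R]_n) : higher_diff 0 f x t = f x.
Proof.
rewrite /higher_diff (big_pred1 [tuple]) => [|k]; last first.
  by apply/esym/eqP/val_inj/size0nil; rewrite size_tuple.
by rewrite big_ord0 mulr1.
Qed.

(** A linear combination of functions is the form to which the differentiation rules for sums and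
    multiples apply. *)
Lemma higher_diffE (R : realType) (n j : nat) (f : 'rV[R]_n -> R)
    (t : 'rV[R]_n) :
  (fun y => higher_diff j f y t) = \sum_(k : j.-tuple 'I_n)
    (\prod_(l < j) t 0 (tnth k l)) *: partials k f.
Proof.
apply/funext => y; rewrite fct_sumE; apply: eq_bigr => k _.
by rewrite mulrC.
Qed.

Section ContinuousPartials.
Context (R : realType) (n m : nat) (U : set 'rV[R]_n) (f : 'rV[R]_n -> R).
Context (oU : open U) (fC : continuous_partials U m f).

(** Descending induction on the order, with [d = m - (size k + 1)]. At order [m - 1] the next
    partials are continuous by assumption; below it they are differentiable by induction, hence
    continuous. *)
Lemma differentiable_iterated_partial (k : seq 'I_n) (x : 'rV[R]_n) :
  (size k < m)%N -> U x -> differentiable (partials k f) x.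
Proof.
move=> km; move: (subnKC km); move: (m - (size k).+1)%N => d {km}.
elim: d k x => [|d ih] k x kd Ux; apply: differentiable_partials.
- have NUx : nbhs x U by apply: open_nbhs_nbhs.
  by apply: filterS NUx => y Uy i; apply: fC.1 => //; rewrite -kd addn0.
- move=> i; have ikm : size (i :: k) == m by rewrite -kd addn0.
  exact: (fC.2 (Tuple ikm)).
- have NUx : nbhs x U by apply: open_nbhs_nbhs.
  apply: filterS NUx => y Uy i; apply: fC.1 => //.
  by rewrite -kd addSn ltnS leq_addr.
- move=> i; apply: (differentiable_continuous (f := partials (i :: k) f)).
  by apply: ih => //; rewrite -kd /= !addSn addnS.
Qed.

Lemma differentiable_higher_diff (j : nat) (x t : 'rV[R]_n) :
  (j < m)%N -> U x -> differentiable (fun y => higher_diff j f y t) x.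
Proof.
move=> jm Ux; rewrite higher_diffE.
elim/big_ind : _ => [|u v|k _]; first exact: differentiable_cst.
  exact: differentiableD.
apply: differentiableZ; apply: differentiable_iterated_partial => //.
by rewrite size_tuple.
Qed.

Lemma derive_higher_diff (j : nat) (x t v : 'rV[R]_n) :
  (j < m)%N -> U x ->
  'D_v (fun y => higher_diff j f y t) x = \sum_(k : j.-tuple 'I_n)
    'D_v (partials k f) x * \prod_(l < j) t 0 (tnth k l).
Proof.
move=> jm Ux; rewrite higher_diffE.
apply: (@derive_val _ _ _ x v).
elim/big_ind2 : _ => [|u du w dw|k _]; first exact: is_derive_cst.
  exact: is_deriveD.
rewrite mulrC; apply: is_deriveZ; apply/derivableP/diff_derivable.
by apply: differentiable_iterated_partial; rewrite ?size_tuple.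
Qed.

(** The new derivative is the outermost one, so its index becomes the head of the tuple:
    [partial i (partials k f)] is [partials (i :: k) f] by computation. *)
Lemma derive_higher_diffS (j : nat) (x t : 'rV[R]_n) :
  (j < m)%N -> U x ->
  'D_t (fun y => higher_diff j f y t) x = higher_diff j.+1 f x t.
Proof.
move=> jm Ux; rewrite derive_higher_diff// /higher_diff sum_tuple_cons.
rewrite exchange_big; apply: eq_bigr => k _ /=.
rewrite derive_row; last first.
  by apply: differentiable_iterated_partial; rewrite ?size_tuple.
rewrite mulr_suml; apply: eq_bigr => i _.
rewrite big_ord_recl [RHS]mulrCA mulrA; congr (_ * _ * _).
by apply: eq_bigr => l _; rewrite tnthS.
Qed.

Context (fH : pos_homogeneous U m f).

Lemma pos_homogeneous_partials (k : seq 'I_n) : (size k <= m)%N ->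
  pos_homogeneous U (m - size k) (partials k f).
Proof.
elim: k => [|i k ih] km; first by rewrite subn0.
apply: pos_homogeneous_partial => //.
  by move=> x Ux; exact: differentiable_iterated_partial.
by rewrite /= subnSK//; apply/ih/ltnW.
Qed.

(** For fixed [t] this is a combination of partials of order [j], each homogeneous of degree
    [m - j]. *)
Lemma euler_higher_diff (j : nat) (x t : 'rV[R]_n) :
  (j < m)%N -> U x ->
  'D_x (fun y => higher_diff j f y t) x = (m - j)%:R * higher_diff j f x t.
Proof.
move=> jm Ux; apply: euler_identity; first exact: differentiable_higher_diff.
have NU : \forall l \near (1 : R), U (l *: x).
  have c1 : l *: x @[l --> (1 : R)] --> x.
    by rewrite -[X in _ --> X]scale1r; apply: cvgZr_tmp; exact: cvg_id.
  by apply: c1; apply: open_nbhs_nbhs.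
apply: filterS2 (lt_nbhsr (@ltr01 R)) NU => l l0 Ul.
rewrite /higher_diff mulr_sumr; apply: eq_bigr => k _; rewrite mulrA.
rewrite pos_homogeneous_partials ?size_tuple//; exact: ltnW.
Qed.

End ContinuousPartials.

(** * The binomial recursion *)

(** The algebra of the induction step, for [r = m] and [X i = (m - i)! v_i]: the left side is what
    [(1 + s) S' - j S] becomes for the sum [S] of order [j]. *)
Lemma sum_pascal_step (R : comNzRingType) (r : R) (j : nat) (X : nat -> R) :
  \sum_(i < j.+1) 'C(j, i)%:R * ((r - i%:R - j%:R) * X i + (r - i%:R) * X i.+1)
  = (r - j%:R) * \sum_(i < j.+2) 'C(j.+1, i)%:R * X i.
Proof.
have pascal : \sum_(i < j.+2) 'C(j.+1, i)%:R * X i =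
    \sum_(i < j.+1) 'C(j, i)%:R * (X i + X i.+1).
  under [RHS]eq_bigr do rewrite mulrDr; rewrite big_split /=.
  rewrite big_ord_recl [in RHS]big_ord_recl -addrA; congr (_ + _).
    by rewrite !bin0.
  rewrite (eq_bigr (fun i : 'I_j.+1 => 'C(j, i.+1)%:R * X i.+1 +
    'C(j, i)%:R * X i.+1)) => [|i _]; last by rewrite lift0 binS natrD mulrDl.
  rewrite big_split /=.
  congr (_ + _); rewrite big_ord_recr /= bin_small// mul0r addr0.
  by apply: eq_bigr.
rewrite pascal mulr_sumr; apply/eqP; rewrite -subr_eq0 -sumrB.
(* The difference of both sides telescopes: [i C(j, i) X_i] is a primitive. *)
pose T i := (i%:R : R) * 'C(j, i)%:R * X i.
rewrite (eq_bigr (fun i : 'I_j.+1 => T i.+1 - T i)) => [|i _].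
  rewrite -(big_mkord xpredT (fun i => T i.+1 - T i)) telescope_sumr//.
  by rewrite /T bin_small// mulr0 !mul0r subr0.
(* Here [(i + 1) C(j, i + 1) = (j - i) C(j, i)]. *)
rewrite /T -natrM mul_bin_left natrM natrB ?ltnS ?leq_ord//.
ring.
Qed.

(** * Expansion of the differential along [b] in differentials along [b - a] *)

Section Expansion.
Context (R : realType) (n m : nat) (U : set 'rV[R]_n) (f : 'rV[R]_n -> R).
Context (oU : open U) (fC : continuous_partials U m f).
Context (fH : pos_homogeneous U m f).
Context (a b : 'rV[R]_n).

(* [(1 + s) b = x + (b - a)] at [x = a + s b], so the derivative along [b]
   splits into an Euler derivative and one along [b - a]. *)
Lemma derive_along_line (i : nat) (s : R) : (i < m)%N ->
  U (s *: b + a) ->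
  (1 + s) * 'D_b (fun y => higher_diff i f y (b - a)) (s *: b + a) =
  (m - i)%:R * higher_diff i f (s *: b + a) (b - a) +
  higher_diff i.+1 f (s *: b + a) (b - a).
Proof.
move=> im Ux; have dh := differentiable_higher_diff oU fC (b - a) im Ux.
rewrite -(euler_higher_diff oU fC fH _ im Ux).
rewrite -(derive_higher_diffS oU fC _ im Ux) !deriveE//.
rewrite -linearD -[LHS]linearZ; congr ('d _ _ _).
by rewrite -addrA [a + _]addrCA subrr addr0 scalerDl scale1r addrC.
Qed.

Lemma higher_diff_expansion (j : nat) (s : R) : (j <= m)%N ->
  U (s *: b + a) ->
  (m - j)`!%:R * ((1 + s) ^+ j * higher_diff j f (s *: b + a) b) =
  \sum_(i < j.+1) 'C(j, i)%:R *
    ((m - i)`!%:R * higher_diff i f (s *: b + a) (b - a)).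
Proof.
elim: j s => [|j ih] s jm Us.
  by rewrite big_ord_recl big_ord0 bin0 expr0 !mul1r addr0 !higher_diff0.
pose W (t : R) : R := higher_diff j f (t *: b + a) b.
pose V i (t : R) : R := (m - i)`!%:R * higher_diff i f (t *: b + a) (b - a).
pose dv i := 'D_b (fun y => higher_diff i f y (b - a)) (s *: b + a).
(* To be differentiated, the identity of order [j] must hold around [s]; hence the induction
   hypothesis for all [s]. *)
have N : \forall t \near s, (m - j)`!%:R * ((1 + t) ^+ j * W t) =
    \sum_(i < j.+1) 'C(j, i)%:R * V i t.
  have NU : \forall t \near s, U (t *: b + a).
    have c : t *: b + a @[t --> s] --> s *: b + a.
      apply: cvgD; last exact: cvg_cst.
      by apply: cvgZr_tmp; exact: cvg_id.
    by apply: c; apply: open_nbhs_nbhs.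
  by apply: filterS NU => t Ut; apply: ih => //; exact: ltnW.
have dW : is_derive s 1 W (higher_diff j.+1 f (s *: b + a) b).
  apply: (is_derive_line (g := fun y => higher_diff j f y b)).
  rewrite -(derive_higher_diffS oU fC)//; apply/derivableP/diff_derivable.
  exact: (differentiable_higher_diff oU fC b jm Us).
have dV i : (i <= j)%N -> is_derive s 1 (V i) ((m - i)`!%:R * dv i).
  move=> ij; rewrite (_ : V i = (m - i)`!%:R *:
    (fun t : R => higher_diff i f (t *: b + a) (b - a) : R))//.
  apply: is_deriveZ.
  apply: (is_derive_line (g := fun y => higher_diff i f y (b - a))).
  apply/derivableP/diff_derivable.
  apply: (differentiable_higher_diff oU fC) => //.
  exact: leq_ltn_trans jm.
have dL : is_derive s 1 (fun t => (m - j)`!%:R * ((1 + t) ^+ j * W t))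
    ((m - j)`!%:R * ((1 + s) ^+ j * higher_diff j.+1 f (s *: b + a) b +
      W s * (j%:R * (1 + s) ^+ j.-1))).
  rewrite (_ : (fun t => _) = (m - j)`!%:R *: ((cst 1 + id) ^+ j * W)).
    apply: is_derive_eq; rewrite !fctE add0r.
    by rewrite /GRing.scale /= mulr1.
  by apply/funext => t; rewrite !fctE.
have dR : is_derive s 1 (fun t => \sum_(i < j.+1) 'C(j, i)%:R * V i t)
    (\sum_(i < j.+1) 'C(j, i)%:R * ((m - i)`!%:R * dv i)).
  rewrite (_ : (fun t => _) = \sum_(i < j.+1) 'C(j, i)%:R *: V i).
    by apply: is_derive_sum => i; apply: is_deriveZ; apply: dV; rewrite -ltnS.
  by apply/funext => t; rewrite fct_sumE.
have eLR : (m - j)`!%:R * ((1 + s) ^+ j * higher_diff j.+1 f (s *: b + a) b +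
      W s * (j%:R * (1 + s) ^+ j.-1)) =
    \sum_(i < j.+1) 'C(j, i)%:R * ((m - i)`!%:R * dv i).
  by have [_ <-] := dR; have [_ <-] := near_eq_is_derive N dL.
(* Multiplying by [m - j] turns [(m - j - 1)!] into [(m - j)!], the factor present in the
   differentiated identity. *)
have mj : m%:R - j%:R != 0 :> R.
  by rewrite -natrB ?(ltnW jm)// pnatr_eq0 subn_eq0 -ltnNge.
apply: (mulfI mj); rewrite -(sum_pascal_step m%:R j (fun i => V i s)).
have fact_pred i : (i <= j)%N ->
    (m - i)`!%:R = (m%:R - i%:R) * (m - i.+1)`!%:R :> R.
  move=> ij; have im : (i < m)%N by exact: leq_ltn_trans jm.
  by rewrite -natrB ?(ltnW im)// -natrM -(subnSK im) factS.
(* With [L] the left side of order [j], the product rule gives [(1 + s) L' = (m - j)! (1 + s)^(j+1)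
   d^(j+1) f + j L]; then [L'] and [L] are replaced by their sums. *)
transitivity (
    (1 + s) * (\sum_(i < j.+1) 'C(j, i)%:R * ((m - i)`!%:R * dv i)) -
    j%:R * \sum_(i < j.+1) 'C(j, i)%:R * V i s).
  rewrite -eLR -(nbhs_singleton N) [LHS]mulrA -fact_pred// exprS.
  (* For [j = 0] the truncated exponent [j.-1] is harmless, its term having the factor [j]. *)
  by case: (j) => [|k] /=; [ring|rewrite exprS; ring].
rewrite !mulr_sumr -sumrB; apply: eq_bigr => i _.
have ij : (i <= j)%N by rewrite -ltnS.
have im : (i < m)%N by exact: leq_ltn_trans jm.
have := derive_along_line im Us; rewrite -/(dv i) natrB ?(ltnW im)// => e.
transitivity ('C(j, i)%:R * ((m - i)`!%:R * ((1 + s) * dv i) - j%:R * V i s)).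
  by ring.
rewrite e /V fact_pred//; ring.
Qed.

End Expansion.

Theorem theorem1 (R : realType) (n m : nat) (hn : (1 <= n)%N) (hm : (1 <= m)%N)
    (U : set 'rV[R]_n) (hU : open U) (f : 'rV[R]_n -> R)
    (hhom : pos_homogeneous U m f) (hC : continuous_partials U m f)
    (a b : 'rV[R]_n) (ha : U a) (hb : U b)
    (hseg : forall t : R, 0 <= t <= 1 -> U (a + t *: (b - a))) :
  taylor_poly m f a (b - a) = (m`!%:R)^-1 * higher_diff m f a b.
Proof.
have Ua : U (0 *: b + a) by rewrite scale0r add0r.
have := higher_diff_expansion hU hC hhom (leqnn m) Ua.
rewrite subnn mul1r addr0 expr1n mul1r scale0r add0r => ->.
(* The value [f a] becomes the term of index 0, and the other weights reduce to
   [C(m, k) (m - k)! / m! = 1 / k!]. *)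
rewrite /taylor_poly -(higher_diff0 f a (b - a)).
rewrite mulr_sumr big_ord_recl; congr (_ + _).
  by rewrite bin0 mul1r subn0 mulKf// pnatr_eq0 -lt0n fact_gt0.
rewrite big_add1 big_mkord; apply: eq_bigr => i _; rewrite lift0 mulrA mulrA.
congr (_ * _).
have fi : (i.+1)`!%:R != 0 :> R by rewrite pnatr_eq0 -lt0n fact_gt0.
have fm : m`!%:R != 0 :> R by rewrite pnatr_eq0 -lt0n fact_gt0.
have binE : m`!%:R = 'C(m, i.+1)%:R * (m - i.+1)`!%:R * (i.+1)`!%:R :> R.
  by rewrite -!natrM -mulnA [X in (_ * X)%N]mulnC bin_fact.
by apply: (mulfI fm); rewrite mulVKf// [X in X / _]binE mulfK.
Qed.
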